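(* For every $\varepsilon>0$ there exist instances of Maximum Vertex Coverage in which the graph is bipartite and has a vertex cover of size $k$ (so the optimum covers all edges), but the greedy algorithm's output covers at most a $\left(1-\frac1e+\varepsilon\right)$ fraction of the edges.
   Context: Maximum Vertex Coverage: given a graph $G$ and a positive integer $k$, choose $k$ vertices so as to maximize the number of edges having at least one endpoint among the chosen vertices. (This is the special case of Maximum Coverage in which each element belongs to exactly two sets.) The greedy algorithm chooses $k$ vertices sequentially, each new vertex maximizing the number of edges it covers that are not yet covered by previously chosen vertices. *)

(* Defs.v *)
From mathcomp Require Import all_boot.
Set Implicit Arguments. Unset Strict Implicit. Unset Printing Implicit Defensive.

Section Graphs.
Variable T : finType.

Definition simple_graph (e : rel T) : Prop := symmetric e /\ irreflexive e.

Definition edges (e : rel T) : {set {set T}} :=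
  [set [set x; y] | x in T, y in T & e x y].

Definition covered (e : rel T) (S : {set T}) : {set {set T}} :=
  [set f in edges e | [exists v in S, v \in f]].

Definition bipartite (e : rel T) : Prop :=
  exists A : {set T}, forall x y, e x y -> (x \in A) != (y \in A).

Definition vertex_cover (e : rel T) (C : {set T}) : Prop :=
  covered e C = edges e.

Definition gain (e : rel T) (P : seq T) (v : T) : nat :=
  #|covered e [set x in v :: P]| - #|covered e [set x in P]|.

(* s (in order of selection) is a possible run of the greedy algorithm:
   each chosen vertex is new and maximizes the number of newly covered edges
   among all vertices not chosen so far (ties broken arbitrarily). *)
Definition greedy_run (e : rel T) (k : nat) (s : seq T) : Prop :=
  size s = k /\ uniq s /\
  forall i, i < k -> forall v : T, v \notin take i s ->
    gain e (take i s) v <= gain e (take i s) (nth v s i).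

End Graphs.

(* Main.v *)
Require Import Defs.
From mathcomp Require Import all_boot zify.
From Stdlib Require Import Reals Lra Lia.
Set Implicit Arguments. Unset Strict Implicit. Unset Printing Implicit Defensive.

(* Construction, for k = n+1.  Picture k*k edge "slots" in a k x k grid, slot
   p lying in row p / k and column p mod k.  Greedy vertices 0, 1, 2, ... take
   consecutive runs of slots; run j has length batch j = k - filled j / k, the
   number of rows not yet started (filled j = slots taken so far).  Greedy
   vertex l is joined to the k cover vertices named by the columns of its
   slots.  Then the cover vertices cover every edge; greedy vertex j gains
   batch j; a cover vertex can gain at most batch j (one edge per unstarted
   row); and batches never grow.  Hence choosing greedy vertices 0 .. k-1 is a
   legal greedy run, covering filled k edges.  Since a batch is at most a 1/k
   fraction of the residual plus one, k^2 - filled j >= k^2 (1-1/k)^j - j, so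
   filled k <= (1 - 1/e) k^2 + 2k, which is below (1 - 1/e + eps) k^2 once
   eps k > 2. *)

Section Decay.
Local Open Scope R_scope.

Lemma inv_e_bounds : 0 < / exp 1 <= 1.
Proof.
have e_ge2 := exp_ineq1_le 1.
split; first exact/Rinv_0_lt_compat/exp_pos.
by rewrite -[X in _ <= X]Rinv_1; apply: Rinv_le_contravar; lra.
Qed.

(* (1 - 1/(n+1))^n = 1/(1 + 1/n)^n >= 1/e, since 1 + x <= exp x. *)
Lemma inv_e_le_pow (n : nat) : / exp 1 <= (1 - / INR n.+1) ^ n.
Proof.
case: n => [|n]; first exact: (proj2 inv_e_bounds).
have n_gt0 : 0 < INR n.+1 by apply: lt_0_INR; lia.
have inv_gt0 : 0 < / INR n.+1 by apply: Rinv_0_lt_compat.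
have -> : 1 - / INR n.+2 = / (1 + / INR n.+1).
  by rewrite (S_INR n.+1); field; lra.
rewrite pow_inv; apply: Rinv_le_contravar; first by apply: pow_lt; lra.
have -> : exp 1 = exp (/ INR n.+1) ^ n.+1.
  rewrite -Rpower_pow; last exact: exp_pos.
  by rewrite /Rpower ln_exp Rinv_r //; lra.
apply: pow_incr; split; first lra.
exact: exp_ineq1_le.
Qed.

(* A sequence obeying r_{j+1} >= q r_j - 1 with 0 <= q <= 1 stays above
   r_0 q^j - j: this is how the residual of the greedy schedule is tracked. *)
Lemma affine_decay (q : R) (r : nat -> R) :
  0 <= q <= 1 -> (forall j, q * r j - 1 <= r j.+1) ->
  forall j, r 0%nat * q ^ j - INR j <= r j.
Proof.
move=> q_bounds r_step; elim=> [|j IH]; first by rewrite /=; lra.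
have j_ge0 := pos_INR j.
have qIH : q * (r 0%nat * q ^ j - INR j) <= q * r j.
  by apply: Rmult_le_compat_l; lra.
have := r_step j; rewrite S_INR /=; nra.
Qed.
End Decay.

Section Schedule.
Variable k : nat.
Hypothesis k_gt0 : 0 < k.

(* The k*k edges to be covered are "slots" 0 .. k*k-1, slot p lying in row
   p %/ k and column p %% k.  The j-th greedy vertex receives the next
   [batch j] consecutive slots, where [filled j] slots are already taken;
   batch j = k - filled j %/ k is the number of rows not yet started. *)
Fixpoint filled (j : nat) : nat :=
  if j is j'.+1 then filled j' + (k - filled j' %/ k) else 0.

Definition batch (j : nat) : nat := k - filled j %/ k.

Lemma filledS j : filled j.+1 = filled j + batch j.
Proof. by []. Qed.

(* A batch never exceeds one row, so its slots lie in distinct columns. *)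
Lemma batch_le j : batch j <= k.
Proof. exact: leq_subr. Qed.

Lemma filled_le j : filled j <= k * k.
Proof.
elim: j => [|j IH] //=; have := divn_eq (filled j) k; have := ltn_pmod (filled j) k_gt0.
nia.
Qed.

Lemma filled_ge j : minn j (k * k) <= filled j.
Proof.
elim: j => [|j IH]; first by rewrite min0n.
have := filled_le j; have := divn_eq (filled j) k; have := ltn_pmod (filled j) k_gt0.
rewrite filledS /batch; nia.
Qed.

Lemma batch_residual j : k * batch j <= (k * k - filled j) + k.
Proof.
have := filled_le j; have := divn_eq (filled j) k; have := ltn_pmod (filled j) k_gt0.
rewrite /batch; nia.
Qed.

Lemma filled_mono : {homo filled : j l / j <= l}.
Proof.
move=> j l /subnK <-; elim: (l - j) => [|i IH] //.
by rewrite addSn filledS (leq_trans IH) ?leq_addr.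
Qed.

(* Greedy batches never grow, which makes the intended order greedy. *)
Lemma batch_anti j l : j <= l -> batch l <= batch j.
Proof. by move=> /filled_mono /(leq_div2r k) le_jl; rewrite /batch leq_sub2l. Qed.

Lemma window_mod_inj a d p q :
  d <= k -> a <= p < a + d -> a <= q < a + d -> p %% k = q %% k -> p = q.
Proof.
wlog le_pq : p q / p <= q => [hwlog|] d_le_k p_in q_in pq_mod.
  by case: (leqP p q) => [|/ltnW] le; [|symmetry]; apply: hwlog.
have k_dvd : k %| q - p by rewrite -eqn_mod_dvd // pq_mod.
apply/eqP; rewrite eqn_leq le_pq /= leqNgt; apply/negP => lt_pq.
have := dvdn_leq (_ : 0 < q - p) k_dvd; rewrite subn_gt0 => /(_ lt_pq); lia.
Qed.

Lemma window_unique l l' p :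
  filled l <= p < filled l.+1 -> filled l' <= p < filled l'.+1 -> l = l'.
Proof.
move=> /andP[lo hi] /andP[lo' hi'].
case: (ltngtP l l') => // [/filled_mono | /filled_mono]; lia.
Qed.
End Schedule.

Lemma residual_lower k j : 0 < k ->
  (INR (k * k) * (1 - / INR k) ^ j - INR j <= INR (k * k - filled k j))%R.
Proof.
move=> k_gt0; have k_ge1 : (1 <= INR k)%R by apply: (le_INR 1); apply/leP.
have inv_k : (0 < / INR k <= 1)%R.
  by split; [apply: Rinv_0_lt_compat | rewrite -Rinv_1; apply: Rinv_le_contravar]; lra.
have := affine_decay (q := 1 - / INR k) (r := fun j => INR (k * k - filled k j)).
rewrite /= subn0; apply=> [|i]; first lra.
rewrite -/(batch k i) -filledS.
have res_split : k * k - filled k i = (k * k - filled k i.+1) + batch k i.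
  by have := filled_le k_gt0 i.+1; rewrite filledS; lia.
have := batch_residual k_gt0 i; move/leP/le_INR; rewrite res_split mult_INR !plus_INR.
set b := INR (batch k i); set X' := INR (_ - filled k i.+1) => batch_bound.
have b_le : (b <= (X' + b) * / INR k + 1)%R.
  apply: (Rmult_le_reg_l (INR k)); first lra.
  have -> : (INR k * ((X' + b) * / INR k + 1) = X' + b + INR k)%R by field; lra.
  lra.
nra.
Qed.

Lemma filled_ratio n (eps : R) : (2 < eps * INR n.+1)%R ->
  (INR (filled n.+1 n.+1) <= (1 - / exp 1 + eps) * INR (n.+1 * n.+1))%R.
Proof.
set K := INR n.+1 => eps_K.
have K_ge1 : (1 <= K)%R by apply: (le_INR 1); apply/leP.
have res := residual_lower n.+1 (ltn0Sn n).
rewrite minus_INR in res; last exact/leP/filled_le.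
rewrite -multE mult_INR -/K in res *.
have inv_e := inv_e_bounds.
have decay : (K * (K - 1) * / exp 1 <= K * K * (1 - / K) ^ n.+1)%R.
  have -> : (K * K * (1 - / K) ^ n.+1 = K * (K - 1) * (1 - / K) ^ n)%R.
    by rewrite /=; field; lra.
  by apply: Rmult_le_compat_l; [nra | exact: inv_e_le_pow].
have slack : (K * / exp 1 + K <= eps * (K * K))%R by nra.
nra.
Qed.

Section Coverage.
Variables (T : finType) (e : rel T).

Lemma edgesP f : reflect (exists x y, e x y /\ f = [set x; y]) (f \in edges e).
Proof.
apply: (iffP imset2P) => [[x y _]|[x [y [exy ->]]]].
  by rewrite inE => exy ->; exists x, y.
by apply: (Imset2spec (x1 := x) (x2 := y)); rewrite ?inE.
Qed.

Lemma edge_covered S x y : e x y ->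
  ([set x; y] \in covered e S) = (x \in S) || (y \in S).
Proof.
move=> exy; rewrite inE; have -> : [set x; y] \in edges e by apply/edgesP; exists x, y.
apply/existsP/orP => [[w /andP[wS]]|[xS|yS]]; last 2 first.
- by exists x; rewrite xS !inE eqxx.
- by exists y; rewrite yS !inE eqxx orbT.
by rewrite !inE => /orP[]/eqP <-; [left | right].
Qed.

Lemma covered_cons_sub (P : seq T) v :
  covered e [set x in P] \subset covered e [set x in v :: P].
Proof.
apply/subsetP => f; rewrite !inE => /andP[-> /existsP[w /andP[wP wf]]].
by apply/existsP; exists w; rewrite !inE wf; rewrite inE in wP; rewrite wP orbT.
Qed.

Lemma card_covered_cons (P : seq T) v :
  #|covered e [set x in v :: P]| = #|covered e [set x in P]| + gain e P v.
Proof. by rewrite /gain subnKC // subset_leq_card // covered_cons_sub. Qed.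

Definition fresh_nbrs (P : seq T) (v : T) : {set T} := [set u | e v u & u \notin P].

Hypotheses (e_sym : symmetric e) (e_irr : irreflexive e).

Lemma covered_cons_new (P : seq T) v : v \notin P ->
  covered e [set x in v :: P] :\: covered e [set x in P] =
  [set [set v; u] | u in fresh_nbrs P v].
Proof.
move=> vP; apply/setP => f; rewrite inE; apply/andP/imsetP.
  case=> f_old f_new; have /edgesP[x [y [exy fE]]] : f \in edges e.
    by move: f_new; rewrite inE => /andP[].
  move: f_old f_new; rewrite fE !edge_covered // !inE.
  case/norP=> xP yP; rewrite (negPf xP) (negPf yP) !orbF => /orP[]/eqP vE; subst v.
  - by exists y; rewrite // inE exy yP.
  - by exists x; rewrite 1?setUC // inE e_sym exy xP.
case=> u; rewrite inE => /andP[evu uP] ->.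
by rewrite !edge_covered // !inE eqxx (negPf vP) (negPf uP).
Qed.

Lemma gain_fresh (P : seq T) v : v \notin P -> gain e P v = #|fresh_nbrs P v|.
Proof.
move=> vP; rewrite /gain -(setIidPr (covered_cons_sub P v)) -cardsD.
rewrite covered_cons_new // card_in_imset // => x y; rewrite !inE => /andP[evx _] _ vxy.
have : x \in [set v; y] by rewrite -vxy !inE eqxx orbT.
by rewrite !inE => /orP[/eqP xv | /eqP //]; rewrite xv e_irr in evx.
Qed.
End Coverage.

Section Construction.
Variable n : nat.
Local Notation k := n.+1.
Local Notation M := (k * k).+1.

(* Vertices: k "cover" vertices inl i and k*k+1 "greedy" vertices inr l;
   greedy vertex l is joined to the columns of its batch of slots. *)
Definition vertex : Type := ('I_k + 'I_M)%type.

Definition adj (i : 'I_k) (l : nat) : bool :=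
  has (fun p => p %% k == i) (iota (filled k l) (batch k l)).

Definition graph : rel vertex := fun u v =>
  match u, v with
  | inl i, inr l | inr l, inl i => adj i l
  | _, _ => false
  end.

Definition cover : {set vertex} := [set u : vertex | if u is inl _ then true else false].

Definition greedy_vertex (j : nat) : vertex := inr (inord j).

Definition greedy_seq (j : nat) : seq vertex := mkseq greedy_vertex j.

Lemma graph_sym : symmetric graph. Proof. by case=> [i|l] [i'|l']. Qed.

Lemma graph_irr : irreflexive graph. Proof. by case. Qed.

Lemma graph_bipartite : bipartite graph.
Proof. by exists cover => -[i|l] [i'|l']; rewrite !inE. Qed.

Lemma card_cover : #|cover| = k.
Proof.
have -> : cover = inl @: [set: 'I_k].
  by apply/setP => -[i|l]; rewrite !inE; apply/esym/imsetP; [exists i | case].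
by rewrite card_imset ?cardsT ?card_ord //; exact: inl_inj.
Qed.

Lemma cover_is_vertex_cover : vertex_cover graph cover.
Proof.
apply/setP => f; apply/idP/idP => [|/edgesP[x [y [exy ->]]]].
  by rewrite inE => /andP[].
by rewrite edge_covered // !inE; case: x y exy => [i|l] [i'|l'].
Qed.

(* Greedy vertex l has exactly batch l neighbours: its slots lie in distinct
   columns. *)
Lemma card_adj (l : nat) : #|[set i : 'I_k | adj i l]| = batch k l.
Proof.
set s := [seq inord (p %% k) : 'I_k | p <- iota (filled k l) (batch k l)].
have -> : [set i : 'I_k | adj i l] = [set i in s].
  apply/setP => i; rewrite !inE; apply/hasP/mapP => [[p p_in /eqP pi]|[p p_in ->]].
    by exists p => //; apply: val_inj; rewrite /= inordK ?ltn_mod // pi.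
  by exists p => //; rewrite inordK ?ltn_mod.
rewrite cardsE (card_uniqP _) ?size_map ?size_iota //.
rewrite map_inj_in_uniq ?iota_uniq // => p q; rewrite !mem_iota => p_in q_in.
move/(congr1 val); rewrite /= !inordK ?ltn_mod // => pq_mod.
exact: (window_mod_inj (ltn0Sn n) (batch_le k l) p_in q_in pq_mod).
Qed.

Lemma card_fresh_greedy (l : 'I_M) (P : seq vertex) : (forall i, inl i \notin P) ->
  #|fresh_nbrs graph P (inr l)| = batch k l.
Proof.
move=> no_cover; rewrite -card_adj -(card_imset _ (@inl_inj 'I_k 'I_M)).
apply: eq_card => -[i|l']; rewrite !inE; last by apply/esym/imsetP => -[].
rewrite no_cover andbT; apply/idP/imsetP => [|[i' ]]; first by exists i; rewrite ?inE.
by rewrite inE => adj_i' [->].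
Qed.

Definition owner (p : nat) : 'I_M :=
  odflt ord0 [pick l : 'I_M | filled k l <= p < filled k l.+1].

Lemma ownerE (l : 'I_M) p : filled k l <= p < filled k l.+1 -> owner p = l.
Proof.
rewrite /owner; case: pickP => [l' /= l'_p | /(_ l) /= -> //] l_p.
by apply: val_inj; exact: window_unique l'_p l_p.
Qed.

(* Once the greedy vertices before j are chosen, a cover vertex i has at most
   batch j fresh neighbours: each owns a slot in column i and in one of the
   batch j rows not yet started, and distinct owners need distinct rows. *)
Lemma card_fresh_cover (i : 'I_k) j (P : seq vertex) :
  (forall l : 'I_M, inr l \notin P -> j <= l) ->
  #|fresh_nbrs graph P (inl i)| <= batch k j.
Proof.
move=> chosen_before_j.
set S := [set l : 'I_M | adj i l & j <= l].
set rows := iota (filled k j %/ k) (batch k j).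
have fresh_sub : fresh_nbrs graph P (inl i) \subset inr @: S.
  apply/subsetP => -[i'|l]; rewrite !inE // => /andP[adj_il lP].
  by apply/imsetP; exists l; rewrite // inE [adj _ _]adj_il chosen_before_j.
have S_sub : {subset S <= [seq owner (t * k + i) | t <- rows]}.
  move=> l; rewrite inE => /andP[/hasP[p]]; rewrite mem_iota -filledS => p_l /eqP p_col j_l.
  have p_lt : p < k * k by have := filled_le (ltn0Sn n) l.+1; lia.
  apply/mapP; exists (p %/ k); last by rewrite -p_col -divn_eq (ownerE p_l).
  have row_start : filled k j %/ k <= k.
    by rewrite (leq_trans (leq_div2r k (filled_le (ltn0Sn n) j))) // mulnK.
  rewrite /rows mem_iota /batch subnKC // ltn_divLR // p_lt andbT; apply: leq_div2r.
  by have := filled_mono k j_l; lia.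
rewrite (leq_trans (subset_leq_card fresh_sub)) // (leq_trans (leq_imset_card _ _)) //.
have := card_size [seq owner (t * k + i) | t <- rows]; rewrite size_map size_iota.
apply: leq_trans; apply: subset_leq_card; exact/subsetP.
Qed.

Lemma mem_greedy_seq (l : 'I_M) j : j <= M -> (inr l \in greedy_seq j) = (l < j).
Proof.
move=> j_le; apply/mapP/idP => [[x]|l_j].
  by rewrite mem_iota /= => x_j [->]; rewrite inordK //; lia.
by exists (val l); rewrite ?mem_iota //= /greedy_vertex inord_val.
Qed.

Lemma greedy_seq_no_cover (i : 'I_k) j : inl i \notin greedy_seq j.
Proof. by apply/mapP => -[]. Qed.

Lemma gain_greedy_vertex j : j < M ->
  gain graph (greedy_seq j) (greedy_vertex j) = batch k j.
Proof.
move=> j_lt; have fresh : greedy_vertex j \notin greedy_seq j.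
  by rewrite mem_greedy_seq ?(ltnW j_lt) // inordK // ltnn.
rewrite (gain_fresh graph_sym graph_irr fresh) card_fresh_greedy ?inordK //.
by move=> i; rewrite greedy_seq_no_cover.
Qed.

Lemma card_covered_greedy j : j <= M ->
  #|covered graph [set x in greedy_seq j]| = filled k j.
Proof.
elim: j => [|j IH] j_le.
  apply/eqP; rewrite cards_eq0; apply/eqP/setP => f; rewrite !inE.
  by apply/negP => /andP[_ /existsP[w]]; rewrite inE.
have -> : [set x in greedy_seq j.+1] = [set x in greedy_vertex j :: greedy_seq j].
  by apply/setP => x; rewrite /greedy_seq mkseqS !inE mem_rcons.
by rewrite card_covered_cons IH ?gain_greedy_vertex // ltnW.
Qed.

(* All k*k slots are eventually used, so the graph has at least k*k edges. *)
Lemma card_edges_ge : k * k <= #|edges graph|.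
Proof.
have := filled_ge (ltn0Sn n) M; rewrite (minn_idPr (leqnSn _)) -card_covered_greedy //.
by move/leq_trans; apply; apply/subset_leq_card/subsetP => f; rewrite inE => /andP[].
Qed.

(* The first k greedy vertices form a run of the greedy algorithm: at step i
   the intended vertex gains batch i, which bounds every other gain. *)
Lemma greedy_run_greedy_seq : greedy_run graph k (greedy_seq k).
Proof.
have k_le : k <= M by nia.
split; first by rewrite size_mkseq.
split.
  apply/mkseq_uniqP => x y; rewrite !inE => x_lt y_lt [].
  by move/(congr1 val); rewrite /= !inordK //; lia.
move=> i i_lt v; have i_le : i <= M by lia.
rewrite /greedy_seq -map_take take_iota (minn_idPl (ltnW i_lt)) -/(greedy_seq i).
rewrite nth_mkseq // gain_greedy_vertex; last lia.
move=> v_fresh; rewrite (gain_fresh graph_sym graph_irr v_fresh).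
case: v v_fresh => [x|l] v_fresh.
  by apply: card_fresh_cover => l; rewrite mem_greedy_seq //; lia.
rewrite card_fresh_greedy => [|x]; last by rewrite greedy_seq_no_cover.
by apply: batch_anti; move: v_fresh; rewrite mem_greedy_seq //; lia.
Qed.
End Construction.

Theorem lemma5p1 :
  forall eps : R, (0 < eps)%R ->
  exists (T : finType) (e : rel T) (k : nat),
    simple_graph e /\ bipartite e /\
    0 < #|edges e| /\
    (exists C : {set T}, #|C| = k /\ vertex_cover e C) /\
    exists s : seq T, greedy_run e k s /\
      (INR #|covered e [set x in s]| <=
         (1 - / exp 1 + eps) * INR #|edges e|)%R.
Proof.
move=> eps eps_gt0.
have [N [N_inv N_gt0]] := archimed_cor1 (eps / 2) ltac:(lra).
have eps_k : (2 < eps * INR N.+1)%R.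
  have N_pos : (0 < INR N)%R by exact: lt_0_INR.
  have : (/ INR N * INR N = 1)%R by field; lra.
  by rewrite S_INR; nra.
exists (vertex N), (@graph N), N.+1.
split; first by split; [exact: graph_sym | exact: graph_irr].
split; first exact: graph_bipartite.
split; first by apply: leq_trans (card_edges_ge N); rewrite muln_gt0.
split; first by exists (cover N); split; [exact: card_cover | exact: cover_is_vertex_cover].
exists (greedy_seq N N.+1); split; first exact: greedy_run_greedy_seq.
rewrite card_covered_greedy; last by nia.
apply: Rle_trans (filled_ratio eps_k) _; apply: Rmult_le_compat_l.
  by have := inv_e_bounds; lra.
apply: le_INR; apply/leP; exact: card_edges_ge.
Qed.
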